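(* The SDP relaxations $SDP_L$ and $SDP_{LS}$ are equivalent. That is: for every feasible solution $U$ of $SDP_{LS}$, the matrix $Y=WUW^{\mathrm T}$ is feasible for $SDP_L$; conversely, for every feasible $Y$ of $SDP_L$ there is a feasible solution $U$ of $SDP_{LS}$ with $Y=WUW^{\mathrm T}$; and under this correspondence the objective values coincide.
   Context: $G=(V,A)$ is a directed graph with $|V|=n$ vertices and $|A|=m$ arcs, with a source vertex $s\in V$ and a target vertex $t\in V$, $s\neq t$. The incidence matrix $\mathcal{I}$ of $G$ is the $n\times m$ matrix with $\mathcal{I}_{v,e}=1$ if arc $e$ leaves vertex $v$, $-1$ if $e$ enters $v$, and $0$ otherwise; its $i$th row is denoted $a_i^{\mathrm T}$. The vector $b\in\mathbb{R}^n$ is given by $b_s=1$, $b_t=-1$, and $b_i=0$ otherwise. $Q\in\mathbb{R}^{m\times m}$ is a given nonnegative symmetric matrix. The SDP relaxation $SDP_L$ is: minimize $\langle Q,X\rangle$ over symmetric $X\in\mathbb{R}^{m\times m}$ and $x\in\mathbb{R}^m$ subject to $$a_s^{\mathrm T}x=b_s,\quad \operatorname{diag}(X)=x,\quad \begin{pmatrix} X & x \\ x^{\mathrm T} & 1 \end{pmatrix}\succeq0,\quad \langle a_ia_i^{\mathrm T},X\rangle=b_i^2\ \ \forall i\in V\setminus\{t\}.$$ The matrix $Y=\begin{pmatrix} X & x \\ x^{\mathrm T} & 1 \end{pmatrix}$ is called feasible for $SDP_L$ if $(X,x)$ satisfies these constraints, and its objective value is $\langle Q,X\rangle$. Let $T\in\mathbb{R}^{(m+1)\times(n-1)}$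 be the matrix whose columns are the vectors $(a_i^{\mathrm T},-b_i)^{\mathrm T}$, $i\in V\setminus\{t\}$; it is assumed that $T$ has rank $n-1$. Let $W\in\mathbb{R}^{(m+1)\times(m-n+2)}$ be a matrix whose columns form a basis of the orthogonal complement of the column space of $T$ (so $W^{\mathrm T}T=0$). Let $e_{m+1}$ be the last column of the $(m+1)\times(m+1)$ identity matrix and $\hat Q=\begin{pmatrix} Q & 0 \\ 0 & 0 \end{pmatrix}$, a symmetric matrix of order $m+1$. The SDP relaxation $SDP_{LS}$ is: minimize $\langle W^{\mathrm T}\hat QW,U\rangle$ over symmetric $U$ of order $m-n+2$ subject to $$\operatorname{diag}(WUW^{\mathrm T})=WUW^{\mathrm T}e_{m+1},\quad e_{m+1}^{\mathrm T}WUW^{\mathrm T}e_{m+1}=1,\quad U\succeq0.$$ Here $\langle M,N\rangle=\operatorname{trace}(M^{\mathrm T}N)$, $\operatorname{diag}(M)$ is the vector of diagonal entries of $M$, and $\succeq0$ means symmetric positive semidefinite. *)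

(* Defs.v *)
From mathcomp Require Import all_boot all_order all_algebra.
From mathcomp Require Import reals.

Set Implicit Arguments.
Unset Strict Implicit.
Unset Printing Implicit Defensive.

Import Order.TTheory GRing.Theory Num.Theory.

Local Open Scope ring_scope.

(* Parallel arcs are allowed; loops are not, since the incidence entry of a
   loop would have to be both 1 and -1. *)
Record digraph (n m : nat) := Digraph {
  arc_tail : 'I_m -> 'I_n;
  arc_head : 'I_m -> 'I_n;
  arc_loopless : forall e, arc_tail e != arc_head e
}.

Section Matrices.
Variable R : realType.

Definition psdmx k (M : 'M[R]_k) : Prop :=
  M^T = M /\ forall v : 'cV[R]_k, 0 <= (v^T *m M *m v) 0 0.

Definition inner_mx k (M N : 'M[R]_k) : R := \tr (M^T *m N).

Definition diag_col k (M : 'M[R]_k) : 'cV[R]_k := \col_i M i i.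

(* W^T is used because mxalgebra's row_free and (_ <= _)%MS speak of rows;
   (v^T <= W^T)%MS says that v lies in the column space of W. *)
Definition is_basis_orth_compl k p q (T : 'M[R]_(k, q)) (W : 'M[R]_(k, p)) :
    Prop :=
  row_free W^T /\
  forall v : 'cV[R]_k,
    (v^T <= W^T)%MS <->
    (forall u : 'cV[R]_k, (u^T <= T^T)%MS -> u^T *m v = 0).

End Matrices.

Section Relaxations.
Variables (R : realType) (n m : nat).
Implicit Types (G : digraph n m) (s t i : 'I_n) (Q X : 'M[R]_m).
Implicit Types (x : 'cV[R]_m) (Y : 'M[R]_(m + 1)).

Definition incidence G : 'M[R]_(n, m) :=
  \matrix_(v, e) (if arc_tail G e == v then 1
                  else if arc_head G e == v then -1 else 0).

Definition inc_vec G i : 'cV[R]_m := (row i (incidence G))^T.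

Definition demand s t : 'cV[R]_n :=
  \col_i (if i == s then 1 else if i == t then -1 else 0).

Definition bordered X x : 'M[R]_(m + 1) := block_mx X x x^T 1%:M.

Definition sdpL_constraints G s t X x : Prop :=
  [/\ X^T = X,
      ((inc_vec G s)^T *m x) 0 0 = demand s t s 0,
      diag_col X = x,
      psdmx (bordered X x) &
      forall i, i != t ->
        inner_mx (inc_vec G i *m (inc_vec G i)^T) X = demand s t i 0 ^+ 2].

Definition sdpL_feasible G s t Y : Prop :=
  exists X x, Y = bordered X x /\ sdpL_constraints G s t X x.

(* ulsubmx recovers X from Y = bordered X x. *)
Definition sdpL_objective Q Y : R := inner_mx Q (ulsubmx Y).

(* The columns of col_mx (incidence G)^T (- (demand s t)^T) are the vectors
   (a_i^T, - b_i)^T for all i; col' t drops the one with i = t. *)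
Definition Tmx G s t : 'M[R]_(m + 1, n.-1) :=
  col' t (col_mx (incidence G)^T (- (demand s t)^T)).

Definition e_last : 'cV[R]_(m + 1) := delta_mx (rshift m ord0) 0.

Definition Qhat Q : 'M[R]_(m + 1) := block_mx Q 0 0 0.

Definition sdpLS_feasible p (W : 'M[R]_(m + 1, p)) (U : 'M[R]_p) : Prop :=
  [/\ U^T = U,
      diag_col (W *m U *m W^T) = W *m U *m W^T *m e_last,
      (e_last^T *m (W *m U *m W^T) *m e_last) 0 0 = 1 &
      psdmx U].

Definition sdpLS_objective p Q (W : 'M[R]_(m + 1, p)) (U : 'M[R]_p) : R :=
  inner_mx (W^T *m Qhat Q *m W) U.

End Relaxations.

(* Main.v *)
Require Import Defs.
From mathcomp Require Import all_boot all_order all_algebra.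
From mathcomp Require Import reals ring.

Set Implicit Arguments.
Unset Strict Implicit.
Unset Printing Implicit Defensive.

Import Order.TTheory GRing.Theory Num.Theory.

Local Open Scope ring_scope.

(* Put w_i = (a_i; -b_i) and Y = [X x; x^T 1]; then
   w_i^T Y w_i = <a_i a_i^T, X> - 2 b_i a_i^T x + b_i^2.
   If Y is feasible for SDP_L this vanishes for all i != t (a_s^T x = b_s is
   needed for i = s only, as b_i = 0 otherwise), so Y w_i = 0 because Y is
   positive semidefinite.  The columns of Y are thus orthogonal to those of T,
   i.e. in the column space of W, and symmetry gives Y = W U W^T with
   U = P Y P^T for a suitable P.  Conversely Y = W U W^T satisfies Y T = 0;
   the last row of Y w_i = 0 reads a_i^T x = b_i, and w_i^T Y w_i = 0 then gives
   <a_i a_i^T, X> = b_i^2. *)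

(** The polynomial in [r] vanishes at 0, so 0 is a minimiser and the derivative [2c] there must be
    zero. Algebraically, at a suitable [r] the value is a negative multiple of [c ^+ 2]. *)
Lemma quad_ge0_linear_coef0 (R : realFieldType) (c d : R) :
  0 <= d -> (forall r, 0 <= (r * c) *+ 2 + r ^+ 2 * d) -> c = 0.
Proof.
move=> d_ge0 quad_ge0; apply/eqP; rewrite -sqrf_eq0 eq_le sqr_ge0 andbT.
have e_gt0 : 0 < d + 1 by rewrite ltr_wpDl.
have e_neq0 : d + 1 != 0 by rewrite gt_eqF.
(* d + 1 in place of d because d may vanish *)
have := quad_ge0 (- c / (d + 1)).
rewrite -(pmulr_lge0 _ (exprn_gt0 2 e_gt0)).
have -> : (- c / (d + 1) * c) *+ 2 + (- c / (d + 1)) ^+ 2 * d =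
          - (c ^+ 2 * (d + 2)) / (d + 1) ^+ 2 by field.
rewrite divfK ?expf_neq0 // oppr_ge0 pmulr_lle0 //.
by rewrite ltr_wpDl.
Qed.

Section Positivity.
Variable R : realType.

Lemma dotmx_eq0 k (w : 'cV[R]_k) : (w^T *m w) 0 0 = 0 -> w = 0.
Proof.
rewrite mxE => /eqP; under eq_bigr do rewrite mxE -expr2.
rewrite psumr_eq0 => [/allP w0|i _]; last exact: sqr_ge0.
apply/colP => i; rewrite mxE; apply/eqP; rewrite -sqrf_eq0.
by have := w0 i (mem_index_enum i).
Qed.

(** Perturb [v] along [w = M v]: by symmetry the form at [v + r w] is [2 r |w|^2 + r^2 w^T M w],
    nonnegative for every [r], which forces [|w|^2 = 0]. *)
Lemma psdmx_ker k (M : 'M[R]_k) (v : 'cV[R]_k) :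
  psdmx M -> (v^T *m M *m v) 0 0 = 0 -> M *m v = 0.
Proof.
move=> [M_sym M_ge0] v_iso; apply: dotmx_eq0; set w := M *m v.
apply: (@quad_ge0_linear_coef0 _ _ _ (M_ge0 w)) => r.
have -> : (r * (w^T *m w) 0 0) *+ 2 + r ^+ 2 * (w^T *m M *m w) 0 0 =
          ((v + r *: w)^T *m M *m (v + r *: w)) 0 0; last exact: M_ge0.
have vM : v^T *m M = w^T by rewrite trmx_mul M_sym.
rewrite [(v + _)^T]raddfD /= [(r *: w)^T]linearZ /= mulmxDl vM !mulmxDl !mulmxDr.
have -> : w^T *m v = v^T *m M *m v by rewrite vM.
rewrite -!scalemxAl -!scalemxAr -[w^T *m M *m v]mulmxA -/w.
rewrite [v^T *m M *m v]mx11_scalar v_iso raddf0 add0r.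
by move: (w^T *m w) (w^T *m M *m w) => a b; rewrite !mxE; ring.
Qed.

Lemma psdmx_congr k l (P : 'M[R]_(l, k)) (M : 'M[R]_k) :
  psdmx M -> psdmx (P *m M *m P^T).
Proof.
move=> [M_sym M_ge0]; split; first by rewrite !trmx_mul trmxK M_sym mulmxA.
by move=> v; have := M_ge0 (P^T *m v); rewrite trmx_mul trmxK !mulmxA.
Qed.

End Positivity.

Lemma col_mulmx (R : pzRingType) k l p (A : 'M[R]_(k, l)) (B : 'M[R]_(l, p)) j :
  col j (A *m B) = A *m col j B.
Proof. by rewrite !colE mulmxA. Qed.

Section OrthogonalComplement.
Variables (R : realType) (k p q : nat).
Variables (T : 'M[R]_(k, q)) (W : 'M[R]_(k, p)).
Hypothesis W_basis : is_basis_orth_compl T W.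

Lemma orth_compl_mulmx0 : T^T *m W = 0.
Proof.
apply/matrixP => i j.
have colW : ((col j W)^T <= W^T)%MS by rewrite tr_col row_sub.
have colT : ((col i T)^T <= T^T)%MS by rewrite tr_col row_sub.
have /matrixP/(_ 0 0) := (W_basis.2 _).1 colW _ colT.
rewrite !mxE => dot0; rewrite -[RHS]dot0.
by apply: eq_bigr => l _; rewrite !mxE.
Qed.

Lemma orth_compl_sub l (M : 'M[R]_(k, l)) : T^T *m M = 0 -> (M^T <= W^T)%MS.
Proof.
move=> TM0; apply/row_subP => i; rewrite -tr_col.
apply/(W_basis.2 _) => u /submxP[D ->].
by rewrite -mulmxA -col_mulmx TM0 linear0 mulmx0.
Qed.

Lemma orth_compl_psd_factor (M : 'M[R]_k) : psdmx M -> M *m T = 0 ->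
  exists2 U : 'M[R]_p, psdmx U & M = W *m U *m W^T.
Proof.
move=> M_psd MT0; have M_sym := M_psd.1.
have TM0 : T^T *m M = 0 by rewrite -M_sym -trmx_mul MT0 trmx0.
have := orth_compl_sub TM0; rewrite M_sym => /mulmxKpV ME.
(* All that is kept of the pseudo-inverse [P] of [W^T] is [M P W^T = M]. Its transpose is
   [W P^T M = M], and the two together collapse [W (P^T M P) W^T] to [M]. *)
move: (pinvmx _) ME => P ME; exists (P^T *m M *m P).
  by rewrite -{2}[P]trmxK; apply: psdmx_congr.
have ME' : W *m P^T *m M = M.
  by have := congr1 trmx ME; rewrite !trmx_mul trmxK M_sym mulmxA.
by rewrite !mulmxA ME' ME.
Qed.

End OrthogonalComplement.

Section Relaxations.
Variables (R : realType) (n m : nat) (G : digraph n m) (s t : 'I_n).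

(** The vector [w_i], indexed by vertices so that the shift [lift t] in the columns of [Tmx] stays
    out of the computations. *)
Definition constraint_vec i : 'cV[R]_(m + 1) :=
  col_mx (inc_vec R G i) (- demand R s t i 0)%:M.

Lemma col_Tmx j : col j (Tmx R G s t) = constraint_vec (lift t j).
Proof.
apply/colP => i; rewrite !mxE; case: splitP => l _; rewrite !mxE //.
by rewrite !ord1 eqxx.
Qed.

Lemma mulmx_Tmx_eq0P l (M : 'M[R]_(l, m + 1)) :
  M *m Tmx R G s t = 0 <-> forall i, i != t -> M *m constraint_vec i = 0.
Proof.
split=> [MT0 i|M0].
  case: (unliftP t i) => [j ->|->]; rewrite ?eqxx // => _.
  by rewrite -col_Tmx -col_mulmx MT0 col0.
apply/matrixP => i j; have := M0 (lift t j).
rewrite eq_sym neq_lift => /(_ isT)/colP/(_ i).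
by rewrite -col_Tmx -col_mulmx !mxE.
Qed.

Lemma bordered_mul_constraint (X : 'M[R]_m) (x : 'cV[R]_m) i :
  bordered X x *m constraint_vec i =
  col_mx (X *m inc_vec R G i - demand R s t i 0 *: x)
         (x^T *m inc_vec R G i - (demand R s t i 0)%:M).
Proof.
by rewrite mul_block_col mul_mx_scalar mul1mx scaleNr raddfN.
Qed.

Lemma inner_rank1 (a : 'cV[R]_m) (X : 'M[R]_m) :
  inner_mx (a *m a^T) X = (a^T *m X *m a) 0 0.
Proof.
by rewrite /inner_mx trmx_mul trmxK -[in LHS]mulmxA mxtrace_mulC trace_mx11.
Qed.

Lemma dot_sym (a x : 'cV[R]_m) : (a^T *m x) 0 0 = (x^T *m a) 0 0.
Proof. by rewrite -[a^T *m x]trmxK trmx_mul trmxK mxE. Qed.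

Lemma constraint_form (X : 'M[R]_m) (x : 'cV[R]_m) i :
  let a := inc_vec R G i in let b := demand R s t i 0 in
  ((constraint_vec i)^T *m bordered X x *m constraint_vec i) 0 0 =
  inner_mx (a *m a^T) X - (b * (a^T *m x) 0 0) *+ 2 + b ^+ 2.
Proof.
move=> a b; rewrite -mulmxA bordered_mul_constraint tr_col_mx mul_row_col.
rewrite tr_scalar_mx mul_scalar_mx mulmxBr -scalemxAr inner_rank1 mulmxA -/a -/b.
have xa : x^T *m a = a^T *m x by apply/colP => k; rewrite ord1 -dot_sym.
rewrite xa; move: (a^T *m X *m a) (a^T *m x) => c d.
by rewrite !mxE /=; ring.
Qed.

Lemma bordered_last (X : 'M[R]_m) (x : 'cV[R]_m) :
  bordered X x *m e_last R m = col_mx x 1%:M.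
Proof.
have -> : e_last R m = col_mx 0 1%:M.
  apply/colP => i; rewrite mxE eqxx andbT -[i]splitK.
  case: (split i) => l; rewrite /= (col_mxEu, col_mxEd) ?eq_lrshift ?mxE //.
  by rewrite ord1 !eqxx.
by rewrite mul_block_col !mulmx0 !mulmx1 !add0r.
Qed.

Lemma diag_bordered (X : 'M[R]_m) (x : 'cV[R]_m) :
  diag_col (bordered X x) = col_mx (diag_col X) 1%:M.
Proof.
apply/colP => i; rewrite mxE -[i]splitK.
case: (split i) => l; rewrite /= (block_mxEul, block_mxEdr) (col_mxEu, col_mxEd).
  by rewrite mxE.
by rewrite !ord1.
Qed.

Lemma e_last_form (Y : 'M[R]_(m + 1)) :
  ((e_last R m)^T *m Y *m e_last R m) 0 0 = drsubmx Y 0 0.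
Proof. by rewrite /e_last trmx_delta -rowE -colE !mxE. Qed.

Lemma inner_Qhat (Q : 'M[R]_m) (Y : 'M[R]_(m + 1)) :
  inner_mx (Qhat Q) Y = inner_mx Q (ulsubmx Y).
Proof.
rewrite /inner_mx -{1}[Y]submxK tr_block_mx !trmx0 mulmx_block mxtrace_block.
by rewrite !mul0mx !addr0 mxtrace0 addr0.
Qed.

End Relaxations.

(* The width of W is m - n + 2, written m.+2 - n because subtraction on nat is
   truncated: m - n may be negative while m + 2 - n is not. *)
Theorem proposition4p2 (R : realType) (n m : nat) (G : digraph n m)
    (s t : 'I_n) (s_neq_t : s != t)
    (Q : 'M[R]_m) (Q_sym : Q^T = Q) (Q_ge0 : forall e f, 0 <= Q e f)
    (rankT : \rank (Tmx R G s t) = n.-1)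
    (W : 'M[R]_(m + 1, m.+2 - n))
    (W_basis : is_basis_orth_compl (Tmx R G s t) W) :
  [/\ forall U : 'M[R]_(m.+2 - n), sdpLS_feasible W U ->
        sdpL_feasible G s t (W *m U *m W^T),
      forall Y : 'M[R]_(m + 1), sdpL_feasible G s t Y ->
        exists U : 'M[R]_(m.+2 - n),
          sdpLS_feasible W U /\ Y = W *m U *m W^T &
      forall U : 'M[R]_(m.+2 - n), sdpLS_feasible W U ->
        sdpL_objective Q (W *m U *m W^T) = sdpLS_objective Q W U].
Proof.
(* Both sides end in the corner entry 1, so only the upper blocks compare. *)
have diagE : forall (X : 'M[R]_m) (x : 'cV[R]_m),
    diag_col (bordered X x) = bordered X x *m e_last R m <-> diag_col X = x.
  move=> X x; rewrite diag_bordered bordered_last.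
  by split=> [/eq_col_mx[]|->].
split=> [U [_ diagU lastU U_psd]
       |Y [X [x [-> [_ eq_s diagX Y_psd eqX]]]]|U _].
- have Y_psd := psdmx_congr W U_psd.
  have YT0 : W *m U *m W^T *m Tmx R G s t = 0.
    rewrite -mulmxA -[Tmx _ _ _ _]trmxK -trmx_mul (orth_compl_mulmx0 W_basis).
    by rewrite trmx0 mulmx0.
  move: (W *m U *m W^T) => Y in diagU lastU Y_psd YT0 *.
  (* Symmetry of [Y] makes its off-diagonal blocks transposes of each other, and [lastU] makes the
     corner 1. *)
  have [X [x YE]] : exists X x, Y = bordered X x.
    exists (ulsubmx Y), (ursubmx Y); rewrite -{1}[Y]submxK /bordered.
    congr block_mx; first by rewrite trmx_ursub Y_psd.1.
    by rewrite [drsubmx Y]mx11_scalar -e_last_form lastU.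
  rewrite {}YE in diagU lastU Y_psd YT0 *.
  exists X, x; split=> //.
  have /(mulmx_Tmx_eq0P G s t) ker := YT0.
  have ax i : i != t -> ((inc_vec R G i)^T *m x) 0 0 = demand R s t i 0.
    move=> /ker; rewrite bordered_mul_constraint -col_mx0 => /eq_col_mx[_].
    move/eqP; rewrite subr_eq0 => /eqP xa.
    by rewrite dot_sym xa mxE eqxx.
  split=> //; [|exact: ax|exact/diagE|].
    by have := Y_psd.1; rewrite /bordered tr_block_mx => /eq_block_mx[].
  move=> i i_t; have /= := constraint_form G s t X x i.
  (* With [a_i^T x = b_i] the vanishing form is [<a_i a_i^T, X> - 2 b_i^2 + b_i^2]. *)
  rewrite ax // -mulmxA ker // mulmx0 [LHS]mxE => form0.
  by apply/eqP; rewrite -subr_eq0 [X in _ == X]form0; apply/eqP; ring.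
- have YT0 : bordered X x *m Tmx R G s t = 0.
    apply/mulmx_Tmx_eq0P => i i_t; apply: psdmx_ker Y_psd _.
    rewrite constraint_form eqX //.
    (* At [s] the form is [b_s^2 - 2 b_s^2 + b_s^2]; at the other vertices [b_i = 0] removes the
       cross term, where [a_i^T x] is not yet known. *)
    have [->|i_s] := eqVneq i s.
      by rewrite eq_s; ring.
    by rewrite mxE (negPf i_s) (negPf i_t); ring.
  have [U U_psd YE] := orth_compl_psd_factor W_basis Y_psd YT0.
  exists U; split=> //; split=> //; rewrite -?YE; first exact: U_psd.1.
    exact/diagE.
  by rewrite e_last_form block_mxKdr mxE eqxx.
(* The zero border of [Qhat] lets all of [Y] replace its block [X]; cyclicity of the trace then
   carries [W^T] to the other end of the product. *)
- rewrite /sdpL_objective -inner_Qhat /sdpLS_objective /inner_mx.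
  by rewrite !trmx_mul trmxK -(mulmxA W^T) [RHS]mxtrace_mulC !mulmxA.
Qed.
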